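(* Let $G$ be a finite group and $\Gamma\subset G$ a union of non-trivial conjugacy classes. If $\Gamma$ generates $G$, then $$H_{2,\Gamma}(G)=H(\Gamma,G):=\ker\partial_\Gamma\cap[\operatorname{Adj}\Gamma,\operatorname{Adj}\Gamma],$$ where the two groups are identified by the group homomorphism $\operatorname{Adj}\Gamma\to G_\Gamma$, $e_a\mapsto\hat a$ ($a\in\Gamma$); that is, this homomorphism maps $H(\Gamma,G)$ isomorphically onto $H_{2,\Gamma}(G)$.
   Context: For $a,b\in G$ write $a^b=b^{-1}ab$. The group $\operatorname{Adj}\Gamma$ is presented by $$\operatorname{Adj}\Gamma=\langle e_g,\ g\in\Gamma\mid e_ae_b=e_be_{a^b},\ a,b\in\Gamma\rangle,$$ and $\partial_\Gamma:\operatorname{Adj}\Gamma\to G$ is the homomorphism $e_g\mapsto g$. Let $F$ be the free group on symbols $\hat g$, $g\in G$, let $R=\ker(F\to G,\ \hat g\mapsto g)$, and let $R_\Gamma$ be the normal subgroup of $F$ normally generated by $[F,R]$ and all elements $\hat a\hat b\hat c^{-1}\hat b^{-1}$ with $a\in\Gamma$, $b\in G$, $c=b^{-1}ab$. Put $G_\Gamma=F/R_\Gamma$ (the class of $\hat g$ is again denoted $\hat g$), with $\alpha:G_\Gamma\to G$ induced by $\hat g\mapsto g$. Then $H_{2,\Gamma}(G)=\ker(G_\Gamma\to G\times G_\Gamma^{ab})$, where the map has components $\alpha$ and the abelianisation. *)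

(* Defs.v *)
From HB Require Import structures.
From mathcomp Require Import fingroup all_boot.
From mathcomp Require Import boolp classical_sets functions.

Set Implicit Arguments.
Unset Strict Implicit.
Unset Printing Implicit Defensive.

Local Open Scope quotient_scope.
Local Open Scope classical_set_scope.
Local Open Scope group_scope.

Section Subgroups.
Variable G : groupType.
Implicit Types (S A B N : set G) (x y g : G).

Definition is_subgroup A := group_closed [in A].

Definition is_normal N := is_subgroup N /\ forall x g, N x -> N (x ^ g).

Definition subgroup_closure S : set G := smallest is_subgroup S.

Definition normal_closure S : set G := smallest is_normal S.

Definition commutator_subgroup A B : set G :=
  subgroup_closure [set z | exists x y, [/\ A x, B y & z = [~ x, y]]].

Lemma is_subgroupP A :
  is_subgroup A <-> A 1 /\ forall x y, A x -> A y -> A (x / y).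
Proof.
split=> -[A1 AF]; split; first exact/set_mem.
- by move=> x y /mem_set Ax /mem_set Ay; apply/set_mem/AF.
- exact/mem_set.
- by move=> x y /set_mem Ax /set_mem Ay; apply/mem_set/AF.
Qed.

Lemma normal_closure_normal S : is_normal (normal_closure S).
Proof.
split; [apply/is_subgroupP; split|].
- by move=> N [[/is_subgroupP[]]].
- move=> x y Sx Sy N NS; have [[/is_subgroupP[_ NF] _] _] := NS.
  by apply: NF; [apply: Sx|apply: Sy].
- by move=> x g Sx N NS; have [[_ NJ] _] := NS; apply: NJ; apply: Sx.
Qed.

Lemma normal_closure1 S : normal_closure S 1.
Proof. by have [/is_subgroupP[]] := normal_closure_normal S. Qed.

Lemma normal_closureF S x y :
  normal_closure S x -> normal_closure S y -> normal_closure S (x / y).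
Proof. have [/is_subgroupP[_ SF] _] := normal_closure_normal S; exact: SF. Qed.

Lemma normal_closureV S x : normal_closure S x -> normal_closure S x^-1.
Proof.
move=> Sx; rewrite -div1g.
exact: (normal_closureF (@normal_closure1 S) Sx).
Qed.

Lemma normal_closureM S x y :
  normal_closure S x -> normal_closure S y -> normal_closure S (x * y).
Proof.
move=> Sx Sy; rewrite -[y]invgK.
exact: (normal_closureF Sx (normal_closureV Sy)).
Qed.

Lemma normal_closureJ S x g : normal_closure S x -> normal_closure S (x ^ g).
Proof. have [_ SJ] := normal_closure_normal S; exact: SJ. Qed.

End Subgroups.

Definition kernel (G H : groupType) (f : G -> H) : set G := [set x | f x = 1].

Lemma kernel_normal (G H : groupType) (f : UMagmaMorphism.type G H) :
  is_normal (kernel f).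
Proof.
split; [apply/is_subgroupP; split|].
- by rewrite /kernel/= gmulf1.
- by move=> x y /= fx fy; rewrite /kernel/= gmulfF fx fy divgg.
- by move=> x g /= fx; rewrite /kernel/= gmulfJ fx conj1g.
Qed.

Section Quotient.
Variables (G : groupType) (S : set G).
Implicit Types x y z : G.

Definition quot_rel x y := `[< normal_closure S (x / y) >].

Lemma quot_rel_refl : reflexive quot_rel.
Proof. by move=> x; apply/asboolP; rewrite divgg; apply: normal_closure1. Qed.

Lemma quot_rel_sym : symmetric quot_rel.
Proof.
by move=> x y; apply/asboolP/asboolP => /normal_closureV; rewrite invgF.
Qed.

Lemma quot_rel_trans : transitive quot_rel.
Proof.
move=> y x z /asboolP xy /asboolP yz; apply/asboolP.
by have := normal_closureM xy yz; rewrite mulgA mulgVK.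
Qed.

Canonical quot_equiv :=
  EquivRel quot_rel quot_rel_refl quot_rel_sym quot_rel_trans.

(* The quotient of [G] by the normal closure of [S]. *)
Definition quotient_group := {eq_quot quot_equiv}.

HB.instance Definition _ := Choice.on quotient_group.
HB.instance Definition _ := EqQuotient.on quotient_group.

Definition quot_proj x : quotient_group := \pi_quotient_group x.

Lemma quot_projW (P : quotient_group -> Prop) :
  (forall x, P (quot_proj x)) -> forall u, P u.
Proof. exact: quotW. Qed.

Lemma quot_projP x y : quot_proj x = quot_proj y <-> normal_closure S (x / y).
Proof. by split=> [/eqmodP/asboolP|xy] //; apply/eqmodP/asboolP. Qed.

Lemma repr_quot x : normal_closure S (repr (quot_proj x) / x).
Proof. by apply/quot_projP; rewrite /quot_proj reprK. Qed.

Definition quot_one : quotient_group := quot_proj 1.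
Definition quot_mul (u v : quotient_group) := quot_proj (repr u * repr v).
Definition quot_inv (u : quotient_group) := quot_proj (repr u)^-1.

Lemma quot_mulE x y : quot_mul (quot_proj x) (quot_proj y) = quot_proj (x * y).
Proof.
apply/quot_projP; have xx := repr_quot x; have yy := repr_quot y.
set x' := repr (quot_proj x) in xx *; set y' := repr (quot_proj y) in yy *.
have -> : x' * y' / (x * y) = (x' / x) * (y' / y) ^ x^-1.
  by rewrite conjgE invgK invgM !mulgA mulgVK.
exact: (normal_closureM xx (normal_closureJ _ yy)).
Qed.

Lemma quot_invE x : quot_inv (quot_proj x) = quot_proj x^-1.
Proof.
apply/quot_projP; have xx := repr_quot x.
set x' := repr (quot_proj x) in xx *.
have -> : x'^-1 / x^-1 = (x' / x)^-1 ^ x.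
  by rewrite conjgE invgF invgK !mulgA mulVg mul1g.
exact: (normal_closureJ _ (normal_closureV xx)).
Qed.

Lemma quot_mulA : associative quot_mul.
Proof.
by elim/quot_projW=> x; elim/quot_projW=> y; elim/quot_projW=> z; rewrite !quot_mulE mulgA.
Qed.

Lemma quot_mul1 : left_id quot_one quot_mul.
Proof. by elim/quot_projW=> x; rewrite quot_mulE mul1g. Qed.

Lemma quot_1mul : right_id quot_one quot_mul.
Proof. by elim/quot_projW=> x; rewrite quot_mulE mulg1. Qed.

Lemma quot_mulV : left_inverse quot_one quot_inv quot_mul.
Proof. by elim/quot_projW=> x; rewrite quot_invE quot_mulE mulVg. Qed.

Lemma quot_Vmul : right_inverse quot_one quot_inv quot_mul.
Proof. by elim/quot_projW=> x; rewrite quot_invE quot_mulE mulgV. Qed.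

HB.instance Definition _ := isGroup.Build quotient_group
  quot_mulA quot_mul1 quot_1mul quot_mulV quot_Vmul.

Lemma quot_proj_morphism : monoid_morphism quot_proj.
Proof. by split=> // x y; rewrite -quot_mulE. Qed.

HB.instance Definition _ := isUMagmaMorphism.Build G quotient_group
  quot_proj quot_proj_morphism.

(* Only meaningful when [S] is contained in the kernel of [f]. *)
Definition quot_lift (H : groupType) (f : G -> H) (u : quotient_group) : H :=
  f (repr u).

Section Lift.
Variables (H : groupType) (f : UMagmaMorphism.type G H).
Hypothesis Sf : S `<=` kernel f.

Lemma quot_liftE x : quot_lift f (quot_proj x) = f x.
Proof.
have /(_ _ (repr_quot x)) := smallest_sub (kernel_normal f) Sf.
by rewrite /kernel/= gmulfF => /divg1_eq.
Qed.

Lemma quot_lift_morphism : monoid_morphism (quot_lift f).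
Proof.
split; first by exact: (etrans (quot_liftE 1) gmulf1).
elim/quot_projW=> x; elim/quot_projW=> y.
rewrite -gmulfM !quot_liftE; exact: gmulfM.
Qed.

End Lift.
End Quotient.

Definition abelianization (G : groupType) :=
  quotient_group (@commutator_subgroup G [set: G] [set: G]).

HB.instance Definition _ (G : groupType) := Group.on (abelianization G).

Definition ab_proj (G : groupType) : G -> abelianization G :=
  @quot_proj G (@commutator_subgroup G [set: G] [set: G]).

HB.instance Definition _ (G : groupType) :=
  UMagmaMorphism.on (@ab_proj G).

Section FreeGroup.
Variable X : choiceType.

(* [(false, x)] stands for the letter x, and [(true, x)] for its inverse. *)
Definition letter : Type := (bool * X)%type.
HB.instance Definition _ := Choice.on letter.

Implicit Types (l m : letter) (u v w : seq letter).

Definition linv l : letter := (~~ l.1, l.2).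

Definition reduced w := sorted (fun l m => m != linv l) w.

Record free_group := FreeGroup { word :> seq letter; _ : reduced word }.

HB.instance Definition _ := [isSub for word].
HB.instance Definition _ := [Choice of free_group by <:].

Definition push l w :=
  if w is m :: w' then if m == linv l then w' else l :: w else [:: l].

Lemma linvK : involutive linv.
Proof. by case=> b x; rewrite /linv/= negbK. Qed.

Lemma push_reduced l w : reduced w -> reduced (push l w).
Proof.
case: w => [//|m w] mw; rewrite /push; case: ifPn => [_|lm].
  exact: path_sorted mw.
by rewrite /reduced/= lm.
Qed.

Lemma foldr_push_reduced u w : reduced w -> reduced (foldr push w u).
Proof. by move=> rw; elim: u => //= l u; apply: push_reduced. Qed.

Lemma foldr_push_id w : reduced w -> foldr push [::] w = w.
Proof.
elim: w => //= l w IH lw; rewrite IH; last exact: path_sorted lw.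
by case: w lw {IH} => [//|m w] /andP[/negPf ml _] /=; rewrite ml.
Qed.

Lemma pushK l w : reduced w -> push l (push (linv l) w) = w.
Proof.
case: w => [|m w] rw /=; first by rewrite eqxx.
rewrite linvK; case: eqP => [ml|_]; last by rewrite /= eqxx.
rewrite {}ml in rw *.
by case: w rw => [//|n w] /andP[/negPf nl _] /=; rewrite nl.
Qed.

Lemma foldr_push_push l u w : reduced w ->
  foldr push w (push l u) = push l (foldr push w u).
Proof.
move=> rw; case: u => [//|m u] /=; case: eqP => [->|//].
by rewrite pushK// foldr_push_reduced.
Qed.

Lemma foldr_pushA u v w : reduced w ->
  foldr push w (foldr push v u) = foldr push (foldr push w v) u.
Proof. by move=> rw; elim: u => //= l u <-; rewrite foldr_push_push. Qed.

Definition free_one := @FreeGroup [::] isT.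

Definition free_mul (x y : free_group) :=
  FreeGroup (foldr_push_reduced x (valP y)).

Lemma inv_reduced w : reduced w -> reduced (map linv (rev w)).
Proof.
rewrite /reduced sorted_map rev_sorted; apply: sub_sorted => l m /=.
by apply: contra => /eqP ->; rewrite linvK.
Qed.

Definition free_inv (x : free_group) := FreeGroup (inv_reduced (valP x)).

Lemma free_mulA : associative free_mul.
Proof. by move=> x y z; apply: val_inj; rewrite /= foldr_pushA ?(valP z). Qed.

Lemma free_1mul : left_id free_one free_mul.
Proof. by move=> x; apply: val_inj. Qed.

Lemma free_mul1 : right_id free_one free_mul.
Proof. by move=> x; apply: val_inj; rewrite /= foldr_push_id ?(valP x). Qed.

Lemma foldr_pushV u w : reduced w ->
  foldr push (foldr push w u) (map linv (rev u)) = w.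
Proof.
move=> rw; elim: u => //= l u IH.
rewrite rev_cons map_rcons foldr_rcons -{2}[l]linvK pushK ?IH//.
exact: foldr_push_reduced.
Qed.

Lemma free_Vmul : left_inverse free_one free_inv free_mul.
Proof.
move=> x; apply: val_inj => /=.
by rewrite -{1}[word x]foldr_push_id ?(valP x)// foldr_pushV.
Qed.

Lemma free_invK : involutive free_inv.
Proof.
move=> x; apply: val_inj; rewrite /= -map_rev revK -map_comp.
by rewrite (eq_map linvK) map_id.
Qed.

Lemma free_mulV : right_inverse free_one free_inv free_mul.
Proof. by move=> x; rewrite -{1}[x]free_invK free_Vmul. Qed.

HB.instance Definition _ := isGroup.Build free_group
  free_mulA free_1mul free_mul1 free_Vmul free_mulV.

Definition free_gen (x : X) : free_group := @FreeGroup [:: (false, x)] isT.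

Section Lift.
Variables (H : groupType) (f : X -> H).

Definition letter_val l : H := if l.1 then (f l.2)^-1 else f l.2.

Definition free_lift (u : free_group) : H := \prod_(l <- word u) letter_val l.

Lemma letter_valV l : letter_val (linv l) = (letter_val l)^-1.
Proof. by case: l => -[] x; rewrite /letter_val/= ?invgK. Qed.

Lemma prod_push l w :
  \prod_(m <- push l w) letter_val m
    = letter_val l * \prod_(m <- w) letter_val m.
Proof.
case: w => [|m w] /=; first by rewrite big_cons.
case: eqP => [->|_]; last by rewrite big_cons.
by rewrite big_cons letter_valV mulVKg.
Qed.

Lemma free_lift_morphism : monoid_morphism free_lift.
Proof.
split=> [|x y]; rewrite /free_lift/=; first by rewrite big_nil.
elim: (word x) => [|l u IH] /=; first by rewrite big_nil mul1g.
by rewrite prod_push IH big_cons mulgA.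
Qed.

HB.instance Definition _ := isUMagmaMorphism.Build free_group H
  free_lift free_lift_morphism.

Lemma free_lift_gen x : free_lift (free_gen x) = f x.
Proof. by rewrite /free_lift/= big_cons big_nil mulg1. Qed.

End Lift.
End FreeGroup.

Definition union_of_nontrivial_classes (gT : finGroupType) (Gamma : {set gT}) :=
  exists P : {set {set gT}},
    {in P, forall C, C \in classes [set: gT]%SET /\ C != [set 1]%SET} /\
    Gamma = finset.cover P.

Section AdjGroup.
Variables (gT : finGroupType) (Gamma : {set gT}).

Definition adj_index : Type := {g : gT | g \in Gamma}.
HB.instance Definition _ := Choice.on adj_index.

Definition adj_relators : set (free_group adj_index) :=
  [set w | exists a b c : adj_index, val c = val a ^ val b /\
    w = (free_gen a * free_gen b) / (free_gen b * free_gen c)].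

Definition Adj := quotient_group adj_relators.
HB.instance Definition _ := Group.on Adj.

Definition adj_gen (a : adj_index) : Adj := quot_proj adj_relators (free_gen a).

Definition adj_bdry : Adj -> gT :=
  quot_lift (free_lift (fun a : adj_index => val a)).

Lemma adj_relators_sub :
  adj_relators `<=` kernel (free_lift (fun a : adj_index => val a)).
Proof.
move=> _ [a [b [c [cE ->]]]]; rewrite /kernel/= gmulfF !gmulfM.
by rewrite /= !free_lift_gen cE -conjgC divgg.
Qed.

HB.instance Definition _ := isUMagmaMorphism.Build Adj gT adj_bdry
  (quot_lift_morphism adj_relators_sub).

Lemma adj_bdry_gen (a : adj_index) : adj_bdry (adj_gen a) = val a.
Proof. exact: etrans (quot_liftE adj_relators_sub _) (free_lift_gen _ _). Qed.

Definition HGammaG : set Adj :=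
  kernel adj_bdry `&` commutator_subgroup [set: Adj] [set: Adj].

End AdjGroup.

Arguments adj_relators {gT} Gamma _.
Arguments HGammaG {gT} Gamma _.

Section GGamma.
Variables (gT : finGroupType) (Gamma : {set gT}).

Definition free_eval : free_group gT -> gT := free_lift (fun g : gT => g).
HB.instance Definition _ := UMagmaMorphism.on free_eval.

(* In [gg_relators], [kernel free_eval] is R. *)
Definition gg_relators : set (free_group gT) :=
  commutator_subgroup [set: free_group gT] (kernel free_eval) `|`
  [set w | exists a b c : gT, [/\ a \in Gamma, c = a ^ b &
    w = free_gen a * free_gen b * (free_gen c)^-1 * (free_gen b)^-1]].

Definition GGamma := quotient_group gg_relators.
HB.instance Definition _ := Group.on GGamma.

Definition gg_gen (g : gT) : GGamma := quot_proj gg_relators (free_gen g).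

Definition gg_proj : GGamma -> gT := quot_lift free_eval.

Lemma gg_relators_sub : gg_relators `<=` kernel free_eval.
Proof.
move=> w [|[a [b [c [_ cE ->]]]]]; last first.
  rewrite /kernel/= !gmulfM !gmulfV /= /free_eval !free_lift_gen cE.
  by rewrite conjgE !invgM invgK !mulgA mulgK mulgK mulgV.
apply: smallest_sub; first exact: (kernel_normal free_eval).1.
move=> _ [x [y [_ /= Ry ->]]]; rewrite /kernel/= gmulfR /=.
by rewrite [free_eval y]Ry commg1.
Qed.

HB.instance Definition _ := isUMagmaMorphism.Build GGamma gT gg_proj
  (quot_lift_morphism gg_relators_sub).

Lemma gg_proj_gen (g : gT) : gg_proj (gg_gen g) = g.
Proof. exact: etrans (quot_liftE gg_relators_sub _) (free_lift_gen _ _). Qed.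

Definition H2Gamma : set GGamma :=
  [set x | (gg_proj x, ab_proj x) = (1, 1)].

End GGamma.

Arguments gg_relators {gT} Gamma _.
Arguments H2Gamma {gT} Gamma _.

(* Main.v *)
(* Conjugation by x in Adj Gamma moves e_a to e_(a ^ bdry x), so ker bdry is
   central.  A set-theoretic section s of bdry with s a = e_a on Gamma thus
   respects the relators of G_Gamma and induces a retraction of
   e_a |-> gg_gen a.  As G_Gamma is the product of the image of Adj Gamma and
   the central subgroup ker alpha, all its commutators come from Adj Gamma. *)
Require Import Defs.
From HB Require Import structures.
From mathcomp Require Import fingroup all_boot.
From mathcomp Require Import boolp classical_sets functions.

Set Implicit Arguments.
Unset Strict Implicit.
Unset Printing Implicit Defensive.

Local Open Scope classical_set_scope.
Local Open Scope group_scope.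

(** * Subgroups, commutators and homomorphisms of abstract groups *)

Section SubgroupTheory.
Variables G H : groupType.
Implicit Types (A B : set G) (f g : UMagmaMorphism.type G H).

Lemma is_subgroupV A x : is_subgroup A -> A x -> A x^-1.
Proof. by move=> /is_subgroupP[A1 AF] Ax; rewrite -div1g; apply: AF. Qed.

Lemma is_subgroupM A x y : is_subgroup A -> A x -> A y -> A (x * y).
Proof.
move=> sA Ax Ay; have /is_subgroupP[_ AF] := sA.
by rewrite -[y]invgK; apply: AF => //; apply: is_subgroupV.
Qed.

Lemma subgroup_closure_subgroup A : is_subgroup (subgroup_closure A).
Proof.
apply/is_subgroupP; split=> [N [/is_subgroupP[]]//|x y Ax Ay N NA].
by have [/is_subgroupP[_ NF] _] := NA; apply: NF; [apply: Ax|apply: Ay].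
Qed.

Lemma commutator_subgroup_comm A B x y :
  A x -> B y -> commutator_subgroup A B [~ x, y].
Proof. by move=> Ax By N [_]; apply; exists x, y. Qed.

Lemma commutator_subgroup_normal : is_normal (commutator_subgroup [set: G] setT).
Proof.
have sD := subgroup_closure_subgroup
  [set z : G | exists x y, [/\ setT x, setT y & z = [~ x, y]]].
split=> // x g Dx.
have -> : x ^ g = x * [~ x, g] by rewrite commgEl mulVKg.
apply: (is_subgroupM sD Dx).
exact: commutator_subgroup_comm.
Qed.

Lemma equalizer_subgroup f g : is_subgroup [set x | f x = g x].
Proof.
apply/is_subgroupP; split=> [|x y /= fgx fgy]; first by rewrite /= !gmulf1.
by rewrite !gmulfF fgx fgy.
Qed.

Lemma preimage_subgroup f (B : set H) : is_subgroup B -> is_subgroup (f @^-1` B).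
Proof.
move=> /is_subgroupP[B1 BF]; apply/is_subgroupP; split=> [|x y Bx By].
  by rewrite /preimage/= gmulf1.
by rewrite /preimage/= gmulfF; apply: BF.
Qed.

Lemma image_subgroup f A : is_subgroup A -> is_subgroup (f @` A).
Proof.
move=> /is_subgroupP[A1 AF]; apply/is_subgroupP; split.
  by exists 1 => //; rewrite gmulf1.
by move=> _ _ [x Ax <-] [y Ay <-]; exists (x / y); [apply: AF|rewrite gmulfF].
Qed.

Lemma commute_subgroup (x : G) : is_subgroup [set y | commute x y].
Proof.
apply/is_subgroupP; split=> [|y z /= xy xz]; first exact: commute1.
by apply: commuteM => //; apply: commuteV.
Qed.

End SubgroupTheory.

(** * Generators and universal property of a group given by a presentation *)

Lemma free_gen_generate (X : choiceType) (A : set (free_group X)) :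
  is_subgroup A -> (forall x, A (free_gen x)) -> forall u, A u.
Proof.
move=> sA Agen [w]; elim: w => [|[b x] w IH] rw.
  have -> : FreeGroup rw = 1 by apply: val_inj.
  by have /is_subgroupP[] := sA.
have rw' : reduced w by apply: path_sorted rw.
have rl : reduced [:: (b, x)] by [].
(* As the word is reduced, [push] cannot cancel its first letter against the tail and merely
   prepends it. *)
have -> : FreeGroup rw = FreeGroup rl * FreeGroup rw'.
  apply: val_inj => /=; case: w rw {IH rw'} => [//|m w] /=.
  by rewrite /reduced/= => /andP[/negPf ->].
apply: (is_subgroupM sA) => //; case: b {rw} rl => rl.
  have -> : FreeGroup rl = (free_gen x)^-1 by apply: val_inj.
  exact: is_subgroupV.
have -> : FreeGroup rl = free_gen x by apply: val_inj.
exact: Agen.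
Qed.

Lemma quot_proj_eq1 (G : groupType) (S : set G) x :
  quot_proj S x = 1 <-> normal_closure S x.
Proof. by rewrite -[x in normal_closure _ x]divg1; apply: quot_projP. Qed.

Lemma quot_proj_relator (G : groupType) (S : set G) x :
  S x -> quot_proj S x = 1.
Proof. by move=> Sx; apply/quot_proj_eq1 => N [_]; apply. Qed.

Lemma presentation_generate (X : choiceType) (S : set (free_group X))
    (A : set (quotient_group S)) :
  is_subgroup A -> (forall x, A (quot_proj S (free_gen x))) -> forall u, A u.
Proof.
move=> sA Agen; elim/quot_projW.
exact: (free_gen_generate (preimage_subgroup (quot_proj S) sA)).
Qed.

(** Von Dyck's theorem, with the map bundled as a morphism so that the morphism laws apply to it. *)
Lemma presentation_lift (X : choiceType) (S : set (free_group X))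
    (H : groupType) (s : X -> H) :
  S `<=` kernel (free_lift s) ->
  exists f : UMagmaMorphism.type (quotient_group S) H,
    forall x, f (quot_proj S (free_gen x)) = s x.
Proof.
move=> sS; pose m := isUMagmaMorphism.Build _ _ _ (quot_lift_morphism sS).
pose f : UMagmaMorphism.type (quotient_group S) H :=
  HB.pack (quot_lift (S := S) (free_lift s)) m.
by exists f => x; apply: etrans (quot_liftE sS _) (free_lift_gen _ _).
Qed.

(** * Central kernels, and the maps between Adj Gamma and G_Gamma *)

Section AdjTheory.
Variables (gT : finGroupType) (Gamma : {set gT}).
Hypothesis GammaJ : forall a b, a \in Gamma -> a ^ b \in Gamma.
Hypothesis Gamma_gen : <<Gamma>> = [set: gT]%SET.
Implicit Types (a c : adj_index Gamma) (x y : Adj Gamma).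

(** For a generator x this is a defining relation; the general case follows since the good x form a
    subgroup. *)
Lemma adj_genJ x a c :
  val c = val a ^ adj_bdry x -> adj_gen a ^ x = adj_gen c.
Proof.
(* Quantifying over [a] and [c] inside the set lets the closure proof apply membership to the
   intermediate conjugate. *)
pose A : set (Adj Gamma) :=
  [set x | forall a c, val c = val a ^ adj_bdry x -> adj_gen a ^ x = adj_gen c].
suff: A x by apply.
apply: presentation_generate => {x a c}; last first.
  move=> b a c; rewrite -/(adj_gen b) adj_bdry_gen => ac.
  apply: (mulgI (adj_gen b)); rewrite -conjgC.
  rewrite /adj_gen -!gmulfM; apply/quot_projP.
  by move=> N [_]; apply; exists a, b, c.
apply/is_subgroupP; split=> [a c|x y Ax Ay a c].
  by rewrite gmulf1 !conjg1 => /val_inj ->.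
rewrite gmulfF !conjgM => ac.
have aJ : val a ^ adj_bdry x \in Gamma by apply/GammaJ/(valP a).
rewrite (Ax a (exist _ (val a ^ adj_bdry x) aJ))//.
apply: (canLR (conjgK _)); apply: esym.
by apply: Ay; rewrite ac conjgKV.
Qed.

Lemma adj_bdry_ker_central x y : adj_bdry x = 1 -> commute x y.
Proof.
move=> x1; apply: presentation_generate y; first exact: commute_subgroup.
move=> a /=; apply/commute_sym/commgP/conjg_fixP/adj_genJ.
by rewrite x1 conjg1.
Qed.

Lemma adj_bdry_surj g : exists x, adj_bdry x = g.
Proof.
(* The image is taken as a finite set, so that generation by Gamma applies to it. *)
pose I := [set h | `[< exists x, @adj_bdry _ Gamma x = h >]]%SET.
have memI h : h \in I <-> exists x, @adj_bdry _ Gamma x = h.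
  by rewrite finset.inE; split=> /asboolP.
have gI : group_set I.
  apply/group_setP; split=> [|h k]; first by apply/memI; exists 1; rewrite gmulf1.
  move=> /memI[x <-] /memI[y <-]; apply/memI.
  by exists (x * y); rewrite gmulfM.
apply/memI; have : g \in <<Gamma>> by rewrite Gamma_gen finset.inE.
apply/fintype.subsetP: g; rewrite (gen_subG _ (group gI)).
apply/fintype.subsetP => a Ga; apply/memI.
by exists (adj_gen (exist _ a Ga)); rewrite adj_bdry_gen.
Qed.

(** An element of ker alpha lifts to R, and the relators [F, R] make the image of R central. *)
Lemma gg_proj_ker_central (u v : GGamma Gamma) : gg_proj u = 1 -> commute u v.
Proof.
elim/quot_projW: u => u; elim/quot_projW: v => v.
rewrite /gg_proj (quot_liftE (@gg_relators_sub _ _)) => u1.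
apply/commute_sym/commgP/eqP; rewrite -gmulfR.
apply: quot_proj_relator; left.
exact: commutator_subgroup_comm.
Qed.

Lemma adj_to_gg_exists :
  exists f : UMagmaMorphism.type (Adj Gamma) (GGamma Gamma),
    forall a, f (adj_gen a) = gg_gen Gamma (val a).
Proof.
apply: presentation_lift => _ [a [b [c [cE ->]]]].
rewrite /kernel/= gmulfF !gmulfM /= !free_lift_gen /gg_gen.
have <- : quot_proj (gg_relators Gamma) (free_gen (val a) * free_gen (val b)
    / (free_gen (val b) * free_gen (val c))) = 1.
  apply: quot_proj_relator; right.
  exists (val a), (val b), (val c); split=> //; first exact: valP.
  by rewrite invgM !mulgA.
by rewrite gmulfF !gmulfM.
Qed.

Lemma gg_to_adj_exists :
  exists h : UMagmaMorphism.type (GGamma Gamma) (Adj Gamma),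
    forall a, h (gg_gen Gamma (val a)) = adj_gen a.
Proof.
(* The second clause forces [s] to agree with a |-> e_a on Gamma; elsewhere any preimage will do. *)
have /choice[s sE] g : exists x, @adj_bdry _ Gamma x = g /\
    forall a, val a = g -> x = adj_gen a.
  have [Gg|Gg] := boolP (g \in Gamma).
    exists (adj_gen (exist _ g Gg)); rewrite adj_bdry_gen; split=> // a ag.
    by congr adj_gen; apply: val_inj.
  have [x xg] := adj_bdry_surj g; exists x; split=> // a ag.
  by rewrite -ag (valP a) in Gg.
(* Hence the lift of [s] to F sends R into ker bdry, which is central, and so kills [F, R]. *)
have sbdry u : adj_bdry (free_lift s u) = free_eval u.
  move: u; apply: free_gen_generate; last first.
    by move=> g /=; rewrite /free_eval !free_lift_gen (sE g).1.
  exact: (equalizer_subgroup (@adj_bdry _ Gamma \o free_lift s) (@free_eval gT)).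
have [|h hE] := @presentation_lift _ (gg_relators Gamma) _ s; last first.
  by exists h => a; rewrite hE; apply: (sE _).2.
move=> w [|[a [b [c [Ga cE ->]]]]].
  apply: smallest_sub; first exact: (kernel_normal (free_lift s)).1.
  move=> _ [x [y [_ Ry ->]]]; rewrite /kernel/= gmulfR; apply/eqP/commgP.
  by apply/commute_sym/adj_bdry_ker_central; rewrite sbdry.
have Gc : c \in Gamma by rewrite cE; apply: GammaJ.
rewrite /kernel/= !gmulfM !gmulfV /= !free_lift_gen.
rewrite ((sE a).2 (exist _ a Ga))// ((sE c).2 (exist _ c Gc))//.
(* Since [s b] lies over b, conjugation by it takes e_a to e_c, which trivialises the relator. *)
rewrite -(@adj_genJ (s b) (exist _ a Ga) (exist _ c Gc)) /= ?(sE b).1//.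
by rewrite [X in X * _ * _]conjgC mulgK mulgV.
Qed.

End AdjTheory.

Theorem proposition6p9 (gT : finGroupType) (Gamma : {set gT})
    (Gamma_classes : union_of_nontrivial_classes Gamma)
    (Gamma_gen : <<Gamma>>%g = [set: gT]%SET) :
  exists f : {multiplicative Adj Gamma -> GGamma Gamma},
    (forall a : adj_index Gamma, f (adj_gen a) = gg_gen Gamma (val a)) /\
    set_bij (HGammaG Gamma) (H2Gamma Gamma) f.
Proof.
have GammaJ a b : a \in Gamma -> a ^ b \in Gamma.
  have [P [PP ->]] := Gamma_classes.
  move=> /bigcupP[C PC aC]; apply/bigcupP; exists C => //.
  have [/imsetP[x _ Cx] _] := PP C PC; move: aC; rewrite {}Cx.
  by move=> /imsetP[y _ ->]; rewrite -conjgM; apply: imset_f; rewrite !inE.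
have [f fE] := adj_to_gg_exists Gamma.
have [h hE] := gg_to_adj_exists GammaJ Gamma_gen.
have fK x : h (f x) = x.
  move: x; apply: presentation_generate => [|a].
    exact: (equalizer_subgroup (h \o f) idfun).
  by rewrite -/(adj_gen a) fE hE.
have fbdry x : gg_proj (f x) = adj_bdry x.
  move: x; apply: presentation_generate => [|a].
    exact: (equalizer_subgroup (@gg_proj _ Gamma \o f) (@adj_bdry _ Gamma)).
  by rewrite -/(adj_gen a) fE gg_proj_gen adj_bdry_gen.
pose D := commutator_subgroup [set: Adj Gamma] setT.
(* Choose x over the image of u in G: then u and [f x] differ by an element of ker alpha, which is
   central. *)
have conj_lift u : exists x, forall v, v ^ u = v ^ f x.
  have [x xu] := adj_bdry_surj Gamma_gen (gg_proj u); exists x => v.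
  have z : gg_proj (u / f x) = 1 by rewrite gmulfF /= fbdry xu mulgV.
  rewrite -[u in LHS](mulgVK (f x)) conjgM; congr (_ ^ _).
  exact/conjg_fixP/commgP/commute_sym/gg_proj_ker_central.
(* The abelianization is a quotient by a normal closure, so the image of [D] has to be shown
   normal. *)
have fDnormal : is_normal (f @` D).
  split; first exact/image_subgroup/(commutator_subgroup_normal _).1.
  move=> _ u [x Dx <-]; have [y ->] := conj_lift u.
  exists (x ^ y); first exact: (commutator_subgroup_normal _).2.
  by rewrite gmulfJ.
(* A commutator depends on each entry only through conjugation by it once the other is fixed, so the
   entries are replaced one at a time. *)
have fDcomm u v : (f @` D) [~ u, v].
  have [y vy] := conj_lift v; have [x ux] := conj_lift u.
  have -> : [~ u, v] = f [~ x, y].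
    by rewrite commgEl vy -commgEl commgEr ux -commgEr gmulfR.
  by exists [~ x, y]; first apply: commutator_subgroup_comm.
exists f; split=> //; split.
(* [f] followed by abelianization kills all commutators, hence [D]. *)
- move=> x [/= x1 Dx]; rewrite /H2Gamma /= fbdry x1; congr pair.
  apply: (Dx (kernel (@ab_proj _ \o f))); split.
    exact: (kernel_normal (@ab_proj _ \o f)).1.
  move=> _ [y [z [_ _ ->]]]; rewrite /kernel/= (gmulfR f).
  apply: quot_proj_relator.
  exact: commutator_subgroup_comm.
- by move=> x y _ _ /(congr1 h); rewrite !fK.
(* Being trivial in the abelianization puts u in every normal subgroup containing all commutators,
   in particular in the image of [D]. *)
- move=> u [u1] /quot_proj_eq1 /(_ (f @` D))[].
    split=> // v; apply; split; first exact: fDnormal.1.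
    by move=> _ [x [y [_ _ ->]]]; apply: fDcomm.
  by move=> x Dx xu; exists x => //; split=> //; rewrite /kernel/= -fbdry xu.
Qed.
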